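(* For $x \in \mathbb{C}$, $l \in \mathbb{N}_0$ and $n\in\mathbb{N}_0$, $$\sum_{k=1}^n k^4 H_k^{(l+5)}(x) = \frac{6x^5 + 15x^4 + 10x^3 - x - n + 10n^3 + 15n^4 + 6n^5}{30} H_n^{(l+5)}(x) - \frac{30x^2(x+1)^2 - 1}{30} H_n^{(l+4)}(x) + x(x+1)(2x+1)H_n^{(l+3)}(x) - \frac{6x^2 + 6x + 1}{3} H_n^{(l+2)}(x) + \frac{2x+1}{2} H_n^{(l+1)}(x) - \frac{H_n^{(l)}(x)}{5}.$$
   Context: For $x\in\mathbb{C}$ and $l,n\in\mathbb{N}_0$, $H_0^{(l)}(x)=0$ and $H_n^{(l)}(x)=\sum_{k=1}^n \frac{1}{(x+k)^l}$ for $n\ge 1$ (defined whenever $x$ is not one of $-1,\dots,-n$). In particular $H_n^{(0)}(x)=n$. *)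

(* Defs.v *)
From mathcomp Require Import all_boot all_order all_algebra.
From mathcomp Require Import reals.
From mathcomp Require Import complex.

Set Implicit Arguments.
Unset Strict Implicit.
Unset Printing Implicit Defensive.

Import GRing.Theory.
Local Open Scope ring_scope.

(* [gharmonic l n x] is H_n^{(l)}(x); the order [l] comes first.  Inversion is
   total in MathComp (0^-1 = 0), so the value is the intended one only when
   x is none of -1, ..., -n. *)
Definition gharmonic (F : fieldType) (l n : nat) (x : F) : F :=
  \sum_(1 <= k < n.+1) 1 / (x + k%:R) ^+ l.

(* Main.v *)
Require Import Defs.
From mathcomp Require Import all_boot all_order all_algebra.
From mathcomp Require Import reals.
From mathcomp Require Import complex.
From mathcomp Require Import ring.

Import GRing.Theory.
Local Open Scope ring_scope.

(** Induction on [n].  Let [S t = (6 t^5 + 15 t^4 + 10 t^3 - t) / 30], so that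
    [S t - S (t - 1) = t^4].  The coefficients of the formula, the [n]-dependent
    part [S n] aside, are those of the Taylor expansion of [S (x - y)] in powers
    of [y].  In the induction step the new terms, at [y = x + n + 1], therefore
    carry the factor [S (n + 1) + S (- (n + 1)) = (n + 1)^4], by the symmetry
    [S (- t) = - S (t - 1)]. *)

Lemma gharmonicS (F : fieldType) (l n : nat) (x : F) :
  gharmonic l n.+1 x = gharmonic l n x + 1 / (x + n.+1%:R) ^+ l.
Proof. by rewrite /gharmonic big_nat_recr. Qed.

(** Characteristic 0 makes the denominators 30, 5, 3 and 2 invertible; [R[i]] is the case of
    interest. *)
Lemma sum_pow4_gharmonic (F : numFieldType) (x : F) (l n : nat)
    (hx : forall k : nat, (1 <= k <= n)%N -> x <> - k%:R) :
  \sum_(1 <= k < n.+1) k%:R ^+ 4 * gharmonic (l + 5) k x =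
    (6 * x ^+ 5 + 15 * x ^+ 4 + 10 * x ^+ 3 - x - n%:R + 10 * n%:R ^+ 3
       + 15 * n%:R ^+ 4 + 6 * n%:R ^+ 5) / 30 * gharmonic (l + 5) n x
    - (30 * x ^+ 2 * (x + 1) ^+ 2 - 1) / 30 * gharmonic (l + 4) n x
    + x * (x + 1) * (2 * x + 1) * gharmonic (l + 3) n x
    - (6 * x ^+ 2 + 6 * x + 1) / 3 * gharmonic (l + 2) n x
    + (2 * x + 1) / 2 * gharmonic (l + 1) n x
    - gharmonic l n x / 5.
Proof.
elim: n hx => [|n IHn] hx; first by rewrite /gharmonic !big_geq //; ring.
rewrite big_nat_recr //= IHn => [|k /andP[k1 kn]]; last first.
  by apply: hx; rewrite k1 leqW.
have y0 : x + n.+1%:R != 0 by rewrite addr_eq0; apply/eqP/hx; rewrite ltnS leqnn.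
(* With [y = x + n + 1], splitting [y ^+ (l + j)] confines the symbolic exponent of the new terms to
   the factor [y ^+ l], which then becomes a nonzero atom [q]. *)
rewrite !gharmonicS !exprD.
move: (expf_neq0 l y0) (y0); move: (_ ^+ l) => q.
rewrite -[n.+1%:R]natr1; move: n%:R => N q0 {}y0.
(* The old sums are atoms and cancel: only the coefficient of [gharmonic (l + 5) n x] depends on
   [n], and it grows by [(n + 1) ^+ 4]. *)
by field; rewrite q0.
Qed.

Theorem theorem29 (R : realType) (x : R[i]) (l n : nat)
    (hx : forall k : nat, (1 <= k <= n)%N -> x <> - k%:R) :
  \sum_(1 <= k < n.+1) k%:R ^+ 4 * gharmonic (l + 5) k x =
    (6 * x ^+ 5 + 15 * x ^+ 4 + 10 * x ^+ 3 - x - n%:R + 10 * n%:R ^+ 3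
       + 15 * n%:R ^+ 4 + 6 * n%:R ^+ 5) / 30 * gharmonic (l + 5) n x
    - (30 * x ^+ 2 * (x + 1) ^+ 2 - 1) / 30 * gharmonic (l + 4) n x
    + x * (x + 1) * (2 * x + 1) * gharmonic (l + 3) n x
    - (6 * x ^+ 2 + 6 * x + 1) / 3 * gharmonic (l + 2) n x
    + (2 * x + 1) / 2 * gharmonic (l + 1) n x
    - gharmonic l n x / 5.
Proof. exact: sum_pow4_gharmonic. Qed.
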